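(* Let $G$ and $H$ be arbitrary connected non-trivial graphs. Then $th(G\Box H)=2$.
   Context: All graphs are finite, undirected, without loops or multiple edges; a graph is non-trivial if it has at least two vertices. The Cartesian product $G\Box H$ has vertex set $V(G)\times V(H)$, and $(g_1,h_1)$, $(g_2,h_2)$ are adjacent when ($g_1g_2\in E(G)$ and $h_1=h_2$) or ($g_1=g_2$ and $h_1h_2\in E(H)$). For distinct non-adjacent vertices $u,v$ of a graph $F$, a tolled walk between $u$ and $v$ is a sequence of vertices $u,w_1,\ldots,w_k,v$ with $k\ge 1$ such that $w_iw_{i+1}\in E(F)$ for all $1\le i<k$, $uw_i\in E(F)$ if and only if $i=1$, and $vw_i\in E(F)$ if and only if $i=k$. If $uv\in E(F)$, the only tolled walk between $u$ and $v$ is $u,v$; the only tolled walk from $v$ to $v$ is $v$ itself. The toll interval $T_F(u,v)$ is the set of all vertices lying on some tolled walk between $u$ and $v$. A set $S\subseteq V(F)$ is t-convex if $T_F(u,v)\subseteq S$ for all $u,v\in S$. The t-convex hull $[S]_t$ of $S\subseteq V(F)$ is the intersection of all t-convex sets containing $S$; $S$ is a t-hull set of $F$ if $[S]_t=V(F)$. The t-hull number $th(F)$ is the minimum size of a t-hull set of $F$. *)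

(* Defs.v *)
From mathcomp Require Import all_boot.
From mathcomp Require Import boolp.

Set Implicit Arguments.
Unset Strict Implicit.
Unset Printing Implicit Defensive.

Record sgraph := SGraph {
  vertex :> finType;
  edge : rel vertex;
  edge_sym : symmetric edge;
  edge_irr : irreflexive edge
}.

Definition connected (G : sgraph) : Prop := forall x y : G, connect (@edge G) x y.

Definition nontrivial (G : sgraph) : bool := 1 < #|G|.

Section CartesianProduct.
Variables G H : sgraph.

Definition cart_edge : rel (G * H) := fun x y =>
  (edge x.1 y.1 && (x.2 == y.2)) || ((x.1 == y.1) && edge x.2 y.2).

Lemma cart_edge_sym : symmetric cart_edge.
Proof.
by move=> x y; rewrite /cart_edge !(edge_sym y.1, edge_sym y.2) !(eq_sym y.1, eq_sym y.2).
Qed.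

Lemma cart_edge_irr : irreflexive cart_edge.
Proof. by move=> x; rewrite /cart_edge !edge_irr andbF. Qed.

Definition cart : sgraph := SGraph cart_edge_sym cart_edge_irr.

End CartesianProduct.

Section TollConvexity.
Variable F : sgraph.
Implicit Types (u v : F) (w p : seq F) (S C : {set F}).

(* [w] is the sequence w_1, ..., w_k of the vertices strictly between [u] and
   [v]; it is indexed from 0, so "i = 1" becomes [i == 0] and "i = k" becomes
   [i == (size w).-1].  The default value of [nth] is never used. *)
Definition tolled_inner u v w : bool :=
  [&& 0 < size w, sorted (@edge F) w &
      [forall i : 'I_(size w),
         (edge u (nth u w i) == (val i == 0)) &&
         (edge v (nth u w i) == (val i == (size w).-1))]].

Definition tolled_walk u v p : Prop :=
  if u == v then p = [:: v]
  else if edge u v then p = [:: u; v]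
  else exists2 w, tolled_inner u v w & p = u :: rcons w v.

Definition toll_interval u v : {set F} :=
  [set x | `[< exists2 p, tolled_walk u v p & x \in p >]].

Definition t_convex S : bool :=
  [forall u in S, forall v in S, toll_interval u v \subset S].

Definition t_hull S : {set F} :=
  \bigcap_(C : {set F} | t_convex C && (S \subset C)) C.

Definition t_hull_set S : bool := t_hull S == [set: F].

Lemma t_hull_setT : t_hull_set [set: F].
Proof.
rewrite /t_hull_set eqEsubset subsetT; apply/bigcapsP => C /andP[_].
by rewrite subTset => /eqP->.
Qed.

(* The minimum is taken over a nonempty family, by [t_hull_setT]. *)
Definition th : nat := #|[arg min_(S < [set: F] | t_hull_set S) #|S|]|.

Lemma th_spec : exists S, [/\ t_hull_set S, #|S| = th &
  forall S', t_hull_set S' -> th <= #|S'|].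
Proof.
by rewrite /th; case: arg_minnP => [|S HS Smin]; [exact: t_hull_setT | exists S].
Qed.

End TollConvexity.

(* Main.v *)
Require Import Defs.
From mathcomp Require Import all_boot.
From mathcomp Require Import boolp.

(** Why the theorem is true.  No singleton is a t-hull set of a graph with at
    least two vertices, because sets of at most one vertex are t-convex; so the
    t-hull number is at least 2.

    For the upper bound, call a vertex [u] of a graph unobtrusive when deleting
    its closed neighbourhood leaves a connected graph to which every neighbour
    of [u] is attached.  If [u] and [v] are distinct, non-adjacent and
    unobtrusive, then any other vertex [x] lies on a tolled walk between them:
    from [x] walk towards [v] without touching the closed neighbourhood of [u],
    stopping at the first neighbour of [v]; walk likewise towards [u] away from
    [v]; then glue the two walks at [x] ([toll_interval_unobtrusive]).  Hence
    [u] and [v] together form a t-hull set.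

    In a Cartesian product, [(g, h)] is unobtrusive as soon as neither [g] nor
    [h] is a cut vertex ([unobtrusive_cart]): what remains after the deletion
    contains the product of [G - g] and [H - h], which is connected, and every
    other remaining vertex is adjacent to that product.  A nontrivial connected
    graph has two distinct non-cut vertices ([noncut_exists], applied twice), so
    one chooses [u] and [v] differing in both coordinates, which makes them
    non-adjacent. *)

Set Implicit Arguments.
Unset Strict Implicit.
Unset Printing Implicit Defensive.

(** * Induced connectivity *)

Lemma connect_homo (T T' : finType) (e : rel T) (e' : rel T') (f : T -> T') :
    {homo f : x y / e x y >-> e' x y} ->
  {homo f : x y / connect e x y >-> connect e' x y}.
Proof.
move=> fE x y /connectP[p pathp ->]; apply/connectP; exists (map f p).
  exact: homo_path pathp.
by rewrite last_map.
Qed.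

Section InducedConnectivity.
Variable F : sgraph.
Implicit Types (A B : {set F}) (x y u v : F).

Definition within A : rel F := [rel x y | [&& x \in A, y \in A & edge x y]].

Definition connected_in A : bool :=
  [forall x in A, forall y in A, connect (within A) x y].

Lemma connected_inP A :
  reflect {in A &, forall x y, connect (within A) x y} (connected_in A).
Proof.
apply: (iffP forall_inP) => [h x y xA yA | h x xA].
  exact: (forall_inP (h x xA)).
by apply/forall_inP => y yA; apply: h.
Qed.

Lemma within_connect_sym A : connect_sym (within A).
Proof.
by apply: sym_connect_sym => x y; rewrite /within /= andbCA edge_sym.
Qed.

Lemma connect_within_sub A B : A \subset B ->
  subrel (connect (within A)) (connect (within B)).
Proof.
move=> /subsetP AB; apply: connect_sub => x y /and3P[/AB xB /AB yB exy].
by apply: connect1; rewrite /within /= xB yB.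
Qed.

(** Connectivity is inherited from a part [B], nonempty because of [z], that
    every vertex of [A] can reach. *)
Lemma connected_in_hub A B z :
    {in B &, forall x y, connect (within A) x y} ->
    (forall x, x \in A -> exists2 y, y \in B & connect (within A) x y) ->
  z \in B -> connected_in A.
Proof.
move=> conB toB zB; have toz x : x \in A -> connect (within A) x z.
  by move=> /toB[y yB]; move/connect_trans; apply; apply: conB.
apply/connected_inP => x y xA yA; apply: connect_trans (toz x xA) _.
by rewrite within_connect_sym toz.
Qed.

Lemma edge_leaving A x y : connect (@edge F) x y -> x \in A -> y \notin A ->
  exists a b, [/\ a \in A, b \notin A & edge a b].
Proof.
case/connectP=> p + ->; elim: p x => [|b p IHp] x /=; first by move=> _ ->.
case/andP=> exb pathp xA lastA; case: (boolP (b \in A)) => [bA | bA].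
  exact: IHp pathp bA lastA.
by exists x, b.
Qed.

Definition noncut x : bool := connected_in [set~ x].

(** A largest connected proper subset containing [r] misses a single vertex,
    since adding a vertex adjacent to it keeps it connected; that vertex is not
    a cut vertex. *)
Lemma noncut_exists : connected F -> nontrivial F ->
  forall r, exists2 y, y != r & noncut y.
Proof.
move=> conF ntF r.
pose P A := [&& connected_in A, r \in A & A != [set: F]].
have P1 : P [set r].
  rewrite /P set11 /=; apply/andP; split.
    by apply/connected_inP => x y /set1P-> /set1P->.
  by apply: contraTneq ntF => rT; rewrite /nontrivial -cardsT -rT cards1.
have [A /maxsetP[/and3P[/connected_inP conA rA ANT] Amax] _] := maxset_exists P1.
have [z _ zA] : exists2 z, z \in [set: F] & z \notin A.
  by apply/subsetPn; rewrite subTset.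
have [a [y [aA yA eay]]] := edge_leaving (conF r z) rA zA.
have AyA : A \subset y |: A by rewrite subsetUr.
have conyA : connected_in (y |: A).
  apply: (@connected_in_hub _ A a) => // [b c bA cA|x].
    by apply: connect_within_sub AyA _ _ _; apply: conA.
  case/setU1P=> [-> | xA]; last by exists x.
  by exists a => //; apply: connect1; rewrite /within /= !inE eqxx aA orbT edge_sym.
have yAT : y |: A = [set: F].
  apply/eqP; apply: contraNT yA => yAT.
  rewrite -(Amax (y |: A)) ?setU11 //.
  by apply/and3P; split=> //; apply: (subsetP AyA).
have defA : A = [set~ y].
  apply/setP => x; have := in_setT x; rewrite -yAT !inE.
  by have [-> _ | _ /= ->] := eqVneq x y; first exact/negbTE.
exists y; first by apply: contraNneq yA => ->.
by rewrite /noncut -defA; apply/connected_inP.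
Qed.

Lemma neighbour_exists : connected F -> nontrivial F ->
  forall x, exists y, edge x y.
Proof.
move=> conF ntF x; have [z zx _] := noncut_exists conF ntF x.
have [||a [b [/set1P-> _ exb]]] := @edge_leaving [set x] _ _ (conF x z).
- exact: set11.
- by rewrite inE.
by exists b.
Qed.

End InducedConnectivity.

(** * Tolled walks between unobtrusive vertices *)

Section TolledWalks.
Variable F : sgraph.
Implicit Types (u v x y : F) (p q s t : seq F).

(** The complement of the closed neighbourhood of [u]. *)
Definition far u : {set F} := [set x | (x != u) && ~~ edge u x].

(** The second condition is what lets a tolled walk from [u] pass through any
    prescribed neighbour [x] of [u]: from [x] it escapes at once to [far u]. *)
Definition unobtrusive u : Prop :=
  connected_in (far u) /\
  (forall x, edge u x -> exists2 y, y \in far u & edge x y).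

Lemma far_sym u v : (v \in far u) = (u \in far v).
Proof. by rewrite !inE eq_sym edge_sym. Qed.

(** Cut a walk ending at [v] at its first neighbour of [v].  The predicate [P]
    serves to carry over the vertices that the walk avoids. *)
Lemma first_neighbour (P : pred F) v x p :
    path (@edge F) x p -> last x p = v -> x != v -> all P p ->
  exists q, [/\ path (@edge F) x q, all P q, edge v (last x q) &
                all (fun y => ~~ edge v y) (belast x q)].
Proof.
elim: p x => [|y p IHp] x /=; first by move=> _ -> /eqP.
case/andP=> exy pathp lastp xv /andP[Py Pp].
have [evx | evx] := boolP (edge v x); first by exists [::].
have yv : y != v by apply: contraNneq evx => <-; rewrite edge_sym.
have [q [pathq Pq eq bq]] := IHp y pathp lastp yv Pp.
by exists (y :: q); rewrite /= exy Py evx.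
Qed.

Lemma connect_far u x y : connect (within (far u)) x y ->
  exists p, [/\ path (@edge F) x p, last x p = y & all [in far u] p].
Proof.
case/connectP=> p pathp ->; exists p; split=> //.
  by apply: sub_path pathp => a b /and3P[].
elim: p x pathp => //= b p IHp x /andP[/and3P[_ -> _]]; exact: IHp.
Qed.

(** One half of a tolled walk through [x].  The vertex [x] itself may be a
    neighbour of [u], in which case it is the one allowed contact with [u]. *)
Lemma half_walk u v x : unobtrusive u -> v \in far u -> x != u -> x != v ->
  exists q, [/\ path (@edge F) x q, all (fun y => ~~ edge u y) q,
                edge v (last x q) & all (fun y => ~~ edge v y) (belast x q)].
Proof.
move=> [/connected_inP conu attu] vu xu xv.
have [p [pathp lastp farp]] :
    exists p, [/\ path (@edge F) x p, last x p = v & all [in far u] p].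
  have [eux | eux] := boolP (edge u x).
    have [y yu exy] := attu x eux.
    have [p [pathp lastp farp]] := connect_far (conu y v yu vu).
    by exists (y :: p); rewrite /= exy yu.
  by apply/connect_far/conu; rewrite // inE xu.
have nearp : all (fun y => ~~ edge u y) p.
  by apply: sub_all farp => y; rewrite inE => /andP[].
exact: first_neighbour pathp lastp xv nearp.
Qed.

Lemma tolled_innerI u v a b s t :
    a :: s = rcons t b -> path (@edge F) a s ->
    edge u a -> all (fun y => ~~ edge u y) s ->
    edge v b -> all (fun y => ~~ edge v y) t ->
  tolled_inner u v (a :: s).
Proof.
move=> def_w pathw eua nus evb nvt; apply/and3P; split=> //.
apply/forallP => -[i /= lti]; apply/andP; split; apply/eqP.
  case: i lti => [|i] //= lti; apply/negbTE.
  by apply: (all_nthP _ nus).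
have sz : size s = size t by have /(congr1 size) := def_w; rewrite size_rcons; case.
rewrite def_w nth_rcons sz; case: ltngtP => [ltit | ltti | _] //.
  by apply/negbTE; apply: (all_nthP _ nvt).
by move: lti; rewrite ltnS sz leqNgt ltti.
Qed.

Lemma toll_interval_unobtrusive u v x :
    unobtrusive u -> unobtrusive v -> v \in far u -> x != u -> x != v ->
  x \in toll_interval u v.
Proof.
move=> Uu Uv vu xu xv; have uv := vu; rewrite far_sym in uv.
have [q2 [path2 nu2 ev nv2]] := half_walk Uu vu xu xv.
have [q1 [path1 nv1 eu nu1]] := half_walk Uv uv xv xu.
(* The inner vertices of the walk, seen from [u] and then from [v]. *)
pose s := rev (belast x q1) ++ q2; pose t := rev q1 ++ belast x q2.
have wE : last x q1 :: s = rev q1 ++ x :: q2.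
  by rewrite /s -cat_cons -rev_rcons -lastI rev_cons cat_rcons.
have wE' : last x q1 :: s = rcons t (last x q2).
  by rewrite wE /t lastI -rcons_cat.
have inner : tolled_inner u v (last x q1 :: s).
  apply: (tolled_innerI wE') => //; last 2 first.
  - by rewrite all_cat all_rev nu1.
  - by rewrite all_cat all_rev nv1.
  rewrite /s cat_path; apply/andP; split.
    by rewrite rev_path; apply: sub_path path1 => a b; rewrite edge_sym.
  suff -> : last (last x q1) (rev (belast x q1)) = x by [].
  by case: (q1) => //= y q; rewrite rev_cons last_rcons.
rewrite inE; apply/asboolP; exists (u :: rcons (last x q1 :: s) v).
  move: vu; rewrite inE eq_sym /tolled_walk => /andP[/negbTE-> /negbTE->].
  by exists (last x q1 :: s).
by rewrite wE !(inE, mem_rcons, mem_cat) eqxx !orbT.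
Qed.

Lemma unobtrusive_hull_set u v :
  unobtrusive u -> unobtrusive v -> v \in far u -> t_hull_set [set u; v].
Proof.
move=> Uu Uv vu; rewrite /t_hull_set eqEsubset subsetT.
apply/bigcapsP => C /andP[/forall_inP convC]; rewrite subUset !sub1set.
case/andP=> uC vC; apply/subsetP => x _.
have [-> // | xu] := eqVneq x u; have [-> // | xv] := eqVneq x v.
have /forall_inP/(_ v vC)/subsetP := convC u uC; apply.
exact: toll_interval_unobtrusive.
Qed.

Lemma t_convex_le1 (S : {set F}) : #|S| <= 1 -> t_convex S.
Proof.
move=> /card_le1_eqP S1; apply/forall_inP => u uS; apply/forall_inP => v vS.
rewrite (S1 u v uS vS); apply/subsetP => x.
by rewrite inE => /asboolP[p]; rewrite /tolled_walk eqxx => -> /[1!inE] /eqP->.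
Qed.

Lemma th_ge2 : nontrivial F -> 1 < th F.
Proof.
move=> ntF; have [S [/eqP hullS <- _]] := th_spec F.
rewrite ltnNge; apply: contraL (ntF) => S1; rewrite /nontrivial -leqNgt.
rewrite -cardsT -hullS; apply: leq_trans (S1); apply: subset_leq_card.
by apply: bigcap_inf; rewrite t_convex_le1 ?subxx.
Qed.

End TolledWalks.

(** * Cartesian products *)

Section Cartesian.
Variables G H : sgraph.
Hypotheses (conG : connected G) (conH : connected H).
Hypotheses (ntG : nontrivial G) (ntH : nontrivial H).

Lemma far_cart (g a : G) (h b : H) :
  a != g -> b != h -> ((a, b) : cart G H) \in far ((g, h) : cart G H).
Proof.
move=> ag bh; rewrite inE xpair_eqE (negbTE ag) /= /edge /= /cart_edge /=.
by rewrite (eq_sym h) (eq_sym g) (negbTE ag) (negbTE bh) andbF.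
Qed.

(** The vertices differing from [(g, h)] in both coordinates form the product of
    [G - g] and [H - h].  They are all far from [(g, h)] and are connected by
    moving in one coordinate at a time; every other far vertex, and every
    neighbour of [(g, h)], shares just one coordinate with [(g, h)], and
    changing that coordinate leads into this product. *)
Lemma unobtrusive_cart (g : G) (h : H) :
  noncut g -> noncut h -> unobtrusive ((g, h) : cart G H).
Proof.
move=> /connected_inP cg /connected_inP ch.
have [g' egg'] := neighbour_exists conG ntG g.
have [h' ehh'] := neighbour_exists conH ntH h.
have neq (F : sgraph) (x y : F) : edge x y -> y != x.
  by apply: contraTneq => ->; rewrite edge_irr.
have [g'g h'h] := (neq _ _ _ egg', neq _ _ _ ehh').
pose core : {set cart G H} := [set z | (z.1 != g) && (z.2 != h)].
split.
  apply: (@connected_in_hub _ _ core (g', h')); last by rewrite inE g'g.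
    move=> [a b] [c d]; rewrite !inE /= => /andP[ag bh] /andP[cg' dh].
    apply: (@connect_trans _ _ ((c, b) : cart G H)).
      have ac : connect (within [set~ g]) a c by apply: cg; rewrite !inE.
      apply: (connect_homo (f := fun x => (x, b))) ac => x y.
      rewrite /within /= !in_setC1 => /and3P[xg yg exy].
      by rewrite !far_cart // /cart_edge /= exy eqxx.
    have bd : connect (within [set~ h]) b d by apply: ch; rewrite !inE.
    apply: (connect_homo (f := fun y => (c, y))) bd => x y.
    rewrite /within /= !in_setC1 => /and3P[xh yh exy].
    by rewrite !far_cart // /cart_edge /= exy eqxx orbT.
  move=> [a b] abu.
  have [ag | ag] := eqVneq a g; last have [bh | bh] := eqVneq b h.
  - (* A far vertex over [g] does not lie over [h], so it can leave sideways. *)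
    have bh : b != h.
      by move: abu; rewrite inE xpair_eqE ag eqxx => /andP[].
    exists (g', b); first by rewrite inE g'g.
    apply: connect1; rewrite /within /= abu far_cart //.
    by rewrite /cart_edge /= ag egg' eqxx.
  - exists (a, h'); first by rewrite inE ag.
    apply: connect1; rewrite /within /= abu far_cart //.
    by rewrite /cart_edge /= bh ehh' eqxx orbT.
  - by exists (a, b); rewrite ?inE ?ag.
move=> [a b]; rewrite /edge /= /cart_edge /=.
case/orP=> /andP[].
  move=> ega /eqP<-; exists (a, h'); first exact: far_cart (neq _ _ _ ega) h'h.
  by rewrite /= eqxx ehh' orbT.
move=> /eqP<- ehb; exists (g', b); first exact: far_cart g'g (neq _ _ _ ehb).
by rewrite /= eqxx egg'.
Qed.

Lemma nontrivial_cart : nontrivial (cart G H).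
Proof. by rewrite /nontrivial card_prod (leq_mul (ltnW ntG) ntH). Qed.

End Cartesian.

Theorem corollary3p10 (G H : sgraph)
  (conG : connected G) (conH : connected H)
  (ntG : nontrivial G) (ntH : nontrivial H) :
  th (cart G H) = 2.
Proof.
apply/eqP; rewrite eqn_leq th_ge2 ?nontrivial_cart // andbT.
have /card_gt0P[g0 _] := ltnW ntG; have /card_gt0P[h0 _] := ltnW ntH.
have [g1 _ cg1] := noncut_exists conG ntG g0.
have [h1 _ ch1] := noncut_exists conH ntH h0.
have [g2 g21 cg2] := noncut_exists conG ntG g1.
have [h2 h21 ch2] := noncut_exists conH ntH h1.
pose u : cart G H := (g1, h1); pose v : cart G H := (g2, h2).
have vu : v \in far u by exact: far_cart.
have uv : u != v by move: vu; rewrite inE eq_sym => /andP[].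
have hull : t_hull_set [set u; v].
  by apply: unobtrusive_hull_set; rewrite ?vu //; apply: unobtrusive_cart.
have [_ [_ _ /(_ _ hull)]] := th_spec (cart G H).
by rewrite cards2 uv.
Qed.
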